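(* Let $A, B, H, K, \lambda$ be real numbers with $A<B$, $H \leq K$, and $\lambda>0$. For $x \in \mathbb{R}$, let $$g(x) = \cosh\left(\frac{B-x}{\lambda}\right) - \cosh\left(\frac{A-x}{\lambda}\right) - \frac{K-H}{\lambda},$$ so that the equation $$\cosh\left(\frac{B-x_{\rm min}}{\lambda}\right) - \cosh\left(\frac{A-x_{\rm min}}{\lambda}\right) = \frac{K-H}{\lambda}$$ becomes $g(x_{\rm min}) = 0$. Then: (a) $g$ is strictly decreasing with $\lim_{x\to-\infty} g(x) = \infty$ and $\lim_{x\to\infty} g(x) = -\infty$, so there is a unique solution, $x_{\rm min}$, of $g(x)=0$; (b) $g\left(\frac{A+B}{2}\right) \leq 0$, so $x_{\rm min} \leq \frac{A+B}{2}$; (c) $g''(x) > 0$ for $-\infty < x < \frac{A+B}{2}$; and (d) Newton's method for $g(x)=0$, starting with the initial guess $\frac{A+B}{2}$, converges to the unique solution, $x_{\rm min}$, of $g(x)=0$.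
   Context: Newton's method for an equation $g(x)=0$ with initial guess $x_0$ is the iteration $x_{n+1} = x_n - g(x_n)/g'(x_n)$, $n \geq 0$. (Background: an inelastic cable is attached at the points $(A,H)$ and $(B,K)$, $\lambda$ is the shape parameter of the resulting catenary, and $x_{\rm min}$ is the horizontal coordinate of the lowest point of the catenary.) *)

(* Defs.v *)
(* Stdlib real numbers, with Coquelicot for limits and derivatives. *)
From Stdlib Require Import Reals.
From Coquelicot Require Import Coquelicot.
Open Scope R_scope.

Definition catenary_fun (A B H K lambda x : R) : R :=
  cosh ((B - x) / lambda) - cosh ((A - x) / lambda) - (K - H) / lambda.

Definition strictly_decreasing (g : R -> R) : Prop :=
  forall x y : R, x < y -> g y < g x.

Fixpoint newton_iter (g : R -> R) (x0 : R) (n : nat) : R :=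
  match n with
  | O => x0
  | S m => newton_iter g x0 m
           - g (newton_iter g x0 m) / Derive g (newton_iter g x0 m)
  end.

(* [Derive] and division are total, so [newton_iter] alone does not express
   that every step of the iteration is meaningful; the first conjunct does. *)
Definition newton_converges_to (g : R -> R) (x0 l : R) : Prop :=
  (forall n : nat, ex_derive g (newton_iter g x0 n) /\
                   Derive g (newton_iter g x0 n) <> 0) /\
  is_lim_seq (newton_iter g x0) l.

(* Main.v *)
Require Import Defs.
From Stdlib Require Import Reals Lra.
From Coquelicot Require Import Coquelicot.
Open Scope R_scope.

(** By the sum-to-product formula, with [m = (A + B) / 2],
    [g x = 2 * sinh ((B - A) / (2 * lambda)) * sinh ((m - x) / lambda)
           - (K - H) / lambda],
    where the leading coefficient is positive and the constant [(K - H) / lambda]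
    is nonnegative.  Since [sinh] is an increasing bijection of the real line
    with inverse [arcsinh], [g] is a strictly decreasing bijection of the line
    ([catenary_fun_surj]); this gives the limits at both infinities and the
    unique root.  At [m] the [sinh] vanishes, so [g m <= 0], and the second
    derivative has the sign of [sinh ((m - x) / lambda)], which is positive to
    the left of [m].

    Newton's method started at [m] converges for any function with a continuous
    negative derivative that is convex on [x <= m] and has its root [r <= m]
    ([newton_converges_convex_decr]).  On that half-line the graph lies above its
    tangents, so the decreasing tangent at any of its points is at most [0] at
    [r], and the Newton step lands weakly to the left of [r], where the function
    is nonnegative.  From the first step on, the iterates therefore increase and
    are bounded by [r]; they converge, and their limit is a zero of the
    function, hence equals [r]. *)

(** * Strictly decreasing functions *)

Lemma is_derive_MVT (f df : R -> R) (x y : R) :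
  (forall t, is_derive f t (df t)) ->
  exists c, Rmin x y <= c <= Rmax x y /\ f y - f x = df c * (y - x).
Proof.
  intros Hd.
  apply MVT_gen; intros t _.
  - apply Hd.
  - apply derivable_continuous_pt.
    exists (df t). apply is_derive_Reals, Hd.
Qed.

Lemma is_derive_neg_decr (f df : R -> R) :
  (forall t, is_derive f t (df t)) -> (forall t, df t < 0) ->
  strictly_decreasing f.
Proof.
  intros Hd Hneg x y Hxy.
  destruct (is_derive_MVT f df x y Hd) as [c [_ Hc]].
  specialize (Hneg c). nra.
Qed.

Lemma strictly_decreasing_inj (f : R -> R) (x y : R) :
  strictly_decreasing f -> f x = f y -> x = y.
Proof.
  intros Hf E.
  destruct (Rtotal_order x y) as [h | [h | h]]; [ | exact h | ];
    apply Hf in h; lra.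
Qed.

Lemma strictly_decreasing_le (f : R -> R) (x y : R) :
  strictly_decreasing f -> f x <= f y -> y <= x.
Proof.
  intros Hf E. apply Rnot_lt_le. intros h. apply Hf in h. lra.
Qed.

Lemma decr_surj_lim_m_infty (f : R -> R) :
  strictly_decreasing f -> (forall y, exists x, f x = y) ->
  is_lim f m_infty p_infty.
Proof.
  intros Hf Hs. apply is_lim_spec. intros M.
  destruct (Hs M) as [N HN].
  exists N. intros x Hx. rewrite <- HN. apply Hf, Hx.
Qed.

Lemma decr_surj_lim_p_infty (f : R -> R) :
  strictly_decreasing f -> (forall y, exists x, f x = y) ->
  is_lim f p_infty m_infty.
Proof.
  intros Hf Hs. apply is_lim_spec. intros M.
  destruct (Hs M) as [N HN].
  exists N. intros x Hx. rewrite <- HN. apply Hf, Hx.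
Qed.

(** * Newton's method for convex decreasing functions *)

(** Convexity on the half-line [x <= m], expressed by a nondecreasing
    derivative, puts the graph above its tangents there. *)
Lemma tangent_below (f df : R -> R) (m x y : R) :
  (forall t, is_derive f t (df t)) ->
  (forall s t, s <= t <= m -> df s <= df t) ->
  x <= m -> y <= m -> f x + df x * (y - x) <= f y.
Proof.
  intros Hd Hmono Hx Hy.
  destruct (is_derive_MVT f df x y Hd) as [c [Hc E]].
  destruct (Rle_dec x y) as [h | h].
  - rewrite Rmin_left, Rmax_right in Hc by lra.
    assert (df x <= df c) by (apply Hmono; lra). nra.
  - rewrite Rmin_right, Rmax_left in Hc by lra.
    assert (df c <= df x) by (apply Hmono; lra). nra.
Qed.

Lemma newton_converges_convex_decr (f df : R -> R) (m r : R) :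
  (forall t, is_derive f t (df t)) ->
  (forall t, continuous df t) ->
  (forall t, df t < 0) ->
  (forall s t, s <= t <= m -> df s <= df t) ->
  f r = 0 -> r <= m ->
  newton_converges_to f m r.
Proof.
  intros Hd Hc Hneg Hmono Hr Hrm.
  assert (HD : forall t, Derive f t = df t)
    by (intros t; apply is_derive_unique, Hd).
  assert (Hdecr := is_derive_neg_decr f df Hd Hneg).
  split.
  { intros n. rewrite HD. split.
    - exists (df (newton_iter f m n)). apply Hd.
    - specialize (Hneg (newton_iter f m n)). lra. }
  set (u := newton_iter f m).
  assert (Hstep : forall n, df (u n) * (u (S n) - u n) = - f (u n)).
  { intros n. unfold u; simpl. rewrite HD.
    field. specialize (Hneg (newton_iter f m n)). lra. }
  (* The tangent at [u n] is decreasing, vanishes at [u (S n)], and at [r] its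
     value is at most [f r = 0]. *)
  assert (Hleft : forall n, u n <= m -> u (S n) <= r).
  { intros n Hn.
    assert (T := tangent_below f df m (u n) r Hd Hmono Hn Hrm).
    specialize (Hstep n). specialize (Hneg (u n)). nra. }
  assert (Hler : forall n, u (S n) <= r).
  { induction n as [ | n IH]; apply Hleft.
    - apply Rle_refl.
    - lra. }
  assert (Hincr : forall n, u (S n) <= u (S (S n))).
  { intros n.
    assert (Hpos : f r <= f (u (S n))).
    { destruct (Hler n) as [h | h].
      - apply Hdecr in h. lra.
      - rewrite h. lra. }
    specialize (Hstep (S n)). specialize (Hneg (u (S n))). nra. }
  destruct (ex_finite_lim_seq_incr (fun n => u (S n)) r Hincr Hler) as [l Hl].
  assert (Hl' := proj2 (is_lim_seq_incr_1 u l) Hl).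
  (* Passing to the limit in the Newton relation gives
     [df l * (l - l) = - f l]. *)
  assert (L1 : is_lim_seq (fun n => - f (u n)) (- f l)).
  { apply (proj1 (is_lim_seq_opp (fun n => f (u n)) (f l))).
    apply (is_lim_seq_continuous f u l); [ | exact Hl'].
    apply derivable_continuous_pt.
    exists (df l). apply is_derive_Reals, Hd. }
  assert (L2 : is_lim_seq (fun n => - f (u n)) (df l * (l - l))).
  { apply (is_lim_seq_ext (fun n => df (u n) * (u (S n) - u n)) _ _ Hstep).
    apply is_lim_seq_mult'.
    - apply (is_lim_seq_continuous df u l); [ | exact Hl'].
      apply continuity_pt_filterlim, Hc.
    - apply is_lim_seq_minus'; assumption. }
  assert (E : Rbar.Finite (- f l) = Rbar.Finite (df l * (l - l))).
  { rewrite <- (is_lim_seq_unique _ _ L1). apply is_lim_seq_unique, L2. }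
  injection E as E.
  assert (l = r) as <-; [ | exact Hl'].
  apply (strictly_decreasing_inj f); [exact Hdecr | lra].
Qed.

(** * The catenary equation *)

Lemma cosh_minus_cosh (p q : R) :
  cosh p - cosh q = 2 * sinh ((p - q) / 2) * sinh ((p + q) / 2).
Proof.
  unfold cosh, sinh.
  set (a := (p - q) / 2). set (b := (p + q) / 2).
  replace p with (a + b) by (unfold a, b; field).
  replace q with (b + - a) by (unfold a, b; field).
  rewrite !Ropp_plus_distr, Ropp_involutive, !exp_plus. field.
Qed.

Lemma cosh_pos (x : R) : 0 < cosh x.
Proof.
  unfold cosh. assert (h1 := exp_pos x). assert (h2 := exp_pos (- x)). lra.
Qed.

Lemma sinh_pos (x : R) : 0 < x -> 0 < sinh x.
Proof. intros Hx. rewrite <- sinh_0. apply sinh_lt, Hx. Qed.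

(** The positive coefficient of [sinh] in the factored form of
    [catenary_fun]. *)
Definition catenary_coef (A B lambda : R) : R :=
  2 * sinh ((B - A) / (2 * lambda)).

Lemma catenary_coef_pos (A B lambda : R) :
  A < B -> 0 < lambda -> 0 < catenary_coef A B lambda.
Proof.
  intros hAB hl.
  apply Rmult_lt_0_compat; [lra | ].
  apply sinh_pos, Rdiv_lt_0_compat; lra.
Qed.

Lemma catenary_fun_sinh (A B H K lambda x : R) :
  0 < lambda ->
  catenary_fun A B H K lambda x =
  catenary_coef A B lambda * sinh (((A + B) / 2 - x) / lambda)
  - (K - H) / lambda.
Proof.
  intros hl. unfold catenary_fun, catenary_coef. rewrite cosh_minus_cosh.
  do 2 f_equal; [do 2 f_equal | f_equal]; field; lra.
Qed.

(** The derivative of [catenary_fun]. *)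
Definition catenary_deriv (A B lambda x : R) : R :=
  - (catenary_coef A B lambda / lambda * cosh (((A + B) / 2 - x) / lambda)).

Lemma is_derive_catenary_fun (A B H K lambda x : R) :
  0 < lambda ->
  is_derive (catenary_fun A B H K lambda) x (catenary_deriv A B lambda x).
Proof.
  intros hl.
  apply (is_derive_ext
    (fun t => catenary_coef A B lambda * sinh (((A + B) / 2 - t) / lambda)
              - (K - H) / lambda)).
  { intros t. symmetry. apply catenary_fun_sinh, hl. }
  unfold catenary_deriv.
  auto_derive; [exact I | ].
  unfold Rdiv, Rminus. field. lra.
Qed.

Lemma is_derive_catenary_deriv (A B lambda x : R) :
  0 < lambda ->
  is_derive (catenary_deriv A B lambda) x
    (catenary_coef A B lambda / lambda ^ 2
     * sinh (((A + B) / 2 - x) / lambda)).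
Proof.
  intros hl. unfold catenary_deriv.
  auto_derive; [exact I | ].
  unfold Rdiv, Rminus. field. lra.
Qed.

Lemma catenary_deriv_neg (A B lambda x : R) :
  A < B -> 0 < lambda -> catenary_deriv A B lambda x < 0.
Proof.
  intros hAB hl. unfold catenary_deriv.
  apply Ropp_lt_gt_0_contravar, Rmult_lt_0_compat.
  - apply Rdiv_lt_0_compat; [apply catenary_coef_pos | ]; assumption.
  - apply cosh_pos.
Qed.

Lemma catenary_second_deriv_pos (A B lambda x : R) :
  A < B -> 0 < lambda -> x < (A + B) / 2 ->
  0 < catenary_coef A B lambda / lambda ^ 2
      * sinh (((A + B) / 2 - x) / lambda).
Proof.
  intros hAB hl hx. apply Rmult_lt_0_compat.
  - apply Rdiv_lt_0_compat;
      [apply catenary_coef_pos; assumption | apply pow_lt, hl].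
  - apply sinh_pos, Rdiv_lt_0_compat; lra.
Qed.

Lemma catenary_deriv_incr (A B lambda s t : R) :
  A < B -> 0 < lambda -> s <= t <= (A + B) / 2 ->
  catenary_deriv A B lambda s <= catenary_deriv A B lambda t.
Proof.
  intros hAB hl Hst.
  destruct (is_derive_MVT (catenary_deriv A B lambda) _ s t
              (fun x => is_derive_catenary_deriv A B lambda x hl))
    as [c [Hc E]].
  rewrite Rmin_left, Rmax_right in Hc by lra.
  destruct (Rle_lt_or_eq_dec c ((A + B) / 2)) as [h | h]; [lra | | ].
  - assert (P := catenary_second_deriv_pos A B lambda c hAB hl h). nra.
  - rewrite h, Rminus_diag, Rdiv_0_l, sinh_0 in E. lra.
Qed.

Lemma catenary_fun_decr (A B H K lambda : R) :
  A < B -> 0 < lambda -> strictly_decreasing (catenary_fun A B H K lambda).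
Proof.
  intros hAB hl. apply (is_derive_neg_decr _ (catenary_deriv A B lambda)).
  - intros t. apply is_derive_catenary_fun, hl.
  - intros t. apply catenary_deriv_neg; assumption.
Qed.

Lemma catenary_fun_surj (A B H K lambda y : R) :
  A < B -> 0 < lambda -> exists x, catenary_fun A B H K lambda x = y.
Proof.
  intros hAB hl.
  assert (hC := catenary_coef_pos A B lambda hAB hl).
  exists ((A + B) / 2
          - lambda * arcsinh ((y + (K - H) / lambda) / catenary_coef A B lambda)).
  rewrite catenary_fun_sinh by exact hl.
  set (a := arcsinh _).
  replace (((A + B) / 2 - ((A + B) / 2 - lambda * a)) / lambda) with a
    by (field; lra).
  unfold a. rewrite sinh_arcsinh. field. lra.
Qed.

Lemma catenary_fun_mid_le0 (A B H K lambda : R) :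
  H <= K -> 0 < lambda -> catenary_fun A B H K lambda ((A + B) / 2) <= 0.
Proof.
  intros hHK hl. rewrite catenary_fun_sinh by exact hl.
  assert (0 <= (K - H) / lambda) by (apply Rdiv_le_0_compat; lra).
  rewrite Rminus_diag, Rdiv_0_l, sinh_0. lra.
Qed.

Theorem proposition2 (A B H K lambda : R)
  (hAB : A < B) (hHK : H <= K) (hlambda : 0 < lambda) :
  let g := catenary_fun A B H K lambda in
  (forall x : R,
     cosh ((B - x) / lambda) - cosh ((A - x) / lambda) = (K - H) / lambda
     <-> g x = 0) /\
  (* (a) *)
  (strictly_decreasing g /\
   is_lim g m_infty p_infty /\
   is_lim g p_infty m_infty /\
   exists! xmin : R, g xmin = 0) /\
  (* (b) *)
  (g ((A + B) / 2) <= 0 /\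
   forall xmin : R, g xmin = 0 -> xmin <= (A + B) / 2) /\
  (* (c) *)
  (forall x : R, x < (A + B) / 2 ->
     ex_derive g x /\ ex_derive_n g 2 x /\ 0 < Derive_n g 2 x) /\
  (* (d) *)
  (forall xmin : R, g xmin = 0 ->
     newton_converges_to g ((A + B) / 2) xmin).
Proof.
  intros g.
  assert (Hdecr : strictly_decreasing g)
    by (apply catenary_fun_decr; assumption).
  assert (Hsurj : forall y, exists x, g x = y)
    by (intros y; apply catenary_fun_surj; assumption).
  assert (Hmid : g ((A + B) / 2) <= 0)
    by (apply catenary_fun_mid_le0; assumption).
  assert (Hroot : forall xmin, g xmin = 0 -> xmin <= (A + B) / 2).
  { intros r Hr. apply (strictly_decreasing_le g); [exact Hdecr | lra]. }
  assert (Hd : forall x, is_derive g x (catenary_deriv A B lambda x))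
    by (intros x; apply is_derive_catenary_fun, hlambda).
  repeat apply conj.
  - intros x. unfold g, catenary_fun. split; lra.
  - exact Hdecr.
  - apply decr_surj_lim_m_infty; assumption.
  - apply decr_surj_lim_p_infty; assumption.
  - destruct (Hsurj 0) as [r Hr]. exists r. split; [exact Hr | ].
    intros r' Hr'. apply (strictly_decreasing_inj g); [exact Hdecr | lra].
  - exact Hmid.
  - exact Hroot.
  - intros x Hx.
    assert (H2 : is_derive (Derive g) x
              (catenary_coef A B lambda / lambda ^ 2
               * sinh (((A + B) / 2 - x) / lambda))).
    { apply (is_derive_ext (catenary_deriv A B lambda)).
      - intros t. symmetry. apply is_derive_unique, Hd.
      - apply is_derive_catenary_deriv, hlambda. }
    repeat apply conj.
    + eexists. apply Hd.
    + simpl. eexists. exact H2.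
    + simpl. erewrite is_derive_unique by exact H2.
      apply catenary_second_deriv_pos; assumption.
  - intros r Hr.
    apply (newton_converges_convex_decr g (catenary_deriv A B lambda)).
    + exact Hd.
    + intros t. apply (ex_derive_continuous (catenary_deriv A B lambda)).
      eexists. apply is_derive_catenary_deriv, hlambda.
    + intros t. apply catenary_deriv_neg; assumption.
    + intros s t. apply catenary_deriv_incr; assumption.
    + exact Hr.
    + apply Hroot, Hr.
Qed.
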